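(* Let $X$ be an infinite Hausdorff space such that $\mathscr{F}(X)$ has at least one continuous selection. Then $$X_\Theta\setminus X_\Omega\subset X_\Theta^*\qquad\text{and}\qquad X_\Theta^*\cap X_\Omega=X_\Omega^*.$$
   Context: All spaces are infinite Hausdorff topological spaces. $\mathscr{F}(X)$ is the set of all nonempty closed subsets of $X$, endowed with the Vietoris topology $\tau_V$, which is generated by the sets $\langle\mathscr{V}\rangle=\{S\in\mathscr{F}(X): S\subset\bigcup\mathscr{V}$ and $S\cap V\neq\varnothing$ for every $V\in\mathscr{V}\}$, where $\mathscr{V}$ runs over the finite families of open subsets of $X$. A selection for $\mathscr{F}(X)$ is a map $f:\mathscr{F}(X)\to X$ with $f(S)\in S$ for every $S\in\mathscr{F}(X)$; it is continuous if it is continuous with respect to $\tau_V$. $X_\Theta=\{f(X): f \text{ is a continuous selection for } \mathscr{F}(X)\}$. A point $p\in X$ is countably-approachable if it is either isolated or there is an open set $U\subset X\setminus\{p\}$ with $\overline{U}=U\cup\{p\}$ such that $p$ has a countable base of clopen sets in the subspace $\overline{U}$. $X_\Omega$ is the set of all countably-approachable points of $X$. A point $p\in X$ is selection maximal if there is a continuous selection $f$ for $\mathscr{F}(X)$ such that $f(S)=p$ for every $S\in\mathscr{F}(X)$ with $p\in S$. $X_\Theta^*=\{p\in X_\Theta: p \text{ is selection maximal}\}$ and $X_\Omega^*=\{p\in X_\Omega: p \text{ has a countable clopen base in } X\}$. *)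

(* Defs.v *)
From HB Require Import structures.
From mathcomp Require Import all_boot all_classical topology.

Set Implicit Arguments.
Unset Strict Implicit.
Unset Printing Implicit Defensive.

Local Open Scope classical_set_scope.

Record hyperspace (X : topologicalType) : Type := Hyperspace {
  hyper_set :> set X;
  hyper_closed : closed hyper_set;
  hyper_neq0 : hyper_set !=set0
}.

HB.instance Definition _ (X : topologicalType) := gen_eqMixin (hyperspace X).
HB.instance Definition _ (X : topologicalType) :=
  gen_choiceMixin (hyperspace X).

Definition vietoris_index (X : topologicalType) : set (set (set X)) :=
  [set V | finite_set V /\ forall A, V A -> open A].

Definition vietoris_set (X : topologicalType) (V : set (set X)) :
    set (hyperspace X) :=
  [set S | hyper_set S `<=` \bigcup_(A in V) A /\
           forall A, V A -> hyper_set S `&` A !=set0].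

HB.instance Definition _ (X : topologicalType) :=
  @isSubBaseTopological.Build (hyperspace X)
    (set (set X)) (@vietoris_index X) (@vietoris_set X).

Definition continuous_selection (X : topologicalType)
    (f : hyperspace X -> X) : Prop :=
  (forall S : hyperspace X, hyper_set S (f S)) /\ continuous f.

(* The hyperspace point [S] with underlying set [setT] is the space itself;
   its existence is part of the condition since it needs [X] nonempty. *)
Definition Theta (X : topologicalType) : set X :=
  [set p | exists2 f : hyperspace X -> X, continuous_selection f &
           exists2 S : hyperspace X, hyper_set S = setT & f S = p].

Definition countable_clopen_base (T : topologicalType) (p : T) : Prop :=
  exists B : set (set T),
    [/\ countable B,
        forall A, B A -> clopen A /\ A p
      & forall N, nbhs p N -> exists2 A, B A & A `<=` N].

(* [closure U], coerced to a type, carries the subspace topology. *)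
Definition countably_approachable (X : topologicalType) (p : X) : Prop :=
  isolated setT p \/
  exists U : set X,
    [/\ open U, U `<=` ~` [set p], closure U = U `|` [set p]
      & exists2 q : closure U, \val q = p & countable_clopen_base q].

Definition Omega (X : topologicalType) : set X :=
  [set p | countably_approachable p].

Definition selection_maximal (X : topologicalType) (p : X) : Prop :=
  exists2 f : hyperspace X -> X, continuous_selection f &
    forall S : hyperspace X, hyper_set S p -> f S = p.

Definition Theta_star (X : topologicalType) : set X :=
  [set p | @Theta X p /\ selection_maximal p].

Definition Omega_star (X : topologicalType) : set X :=
  [set p | @Omega X p /\ countable_clopen_base p].

Arguments Theta : clear implicits.
Arguments Omega : clear implicits.
Arguments Theta_star : clear implicits.
Arguments Omega_star : clear implicits.

(* Main.v *)
Require Import Defs.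
From mathcomp Require Import all_boot finmap all_classical topology.

Set Implicit Arguments.
Unset Strict Implicit.
Unset Printing Implicit Defensive.

Local Open Scope classical_set_scope.

(** A selection is regarded as a function [phi] on sets. Its continuity at [S]
says that [phi T] stays in a given neighbourhood of [phi S] when [T] is Vietoris
close to [S]. Two consequences are used throughout. For a closed [K] the map
[z |-> phi (K `|` [set z])] is continuous, so it pulls clopen sets back to clopen
sets. And if the point selected from [S `|` T] lies in a clopen [N] containing
[S], a closed [O] containing [T] and maximal for this property outside [N] exists
by Zorn's lemma, chains being convergent in the Vietoris topology; it is
necessarily clopen ([clopen_extension]).

Suppose [p] is approached by clopen sets [D n] converging to it. If [phi] selects
[p] from every set containing it and [F] misses [p], then [D n `|` F] is close to
[F `|` [set p]], so that for some [n] a point of [D n] is selected from it. With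
[clopen_extension] this gives clopen neighbourhoods of [p] inside any
neighbourhood; with singletons [F] it makes [p] the intersection of countably
many clopen sets. A decreasing sequence [O n] of such sets, shrinking fast enough
for [phi], is a base: otherwise some closed [F] missing [p] would meet all of
them, and points of [F] would be selected from the sets
[~` O n `|` (F `&` O n.+1)], which converge to the whole space, from which [p] is
selected ([maximal_countable_clopen_base]). Conversely, a countable clopen base
at [p] lets one select from the part of a closed set that is closest to [p]
([countable_clopen_base_maximal]).

Suppose now that [p = phi setT] is not countably-approachable. A sequence of sets
converging to the whole space has selected points converging to [p]; if these
can be caught in clopen sets missing [p], the selection yields nonempty clopen
sets of selected points, and these converge to [p] too. This is impossible, and
it follows that [p] is selected from [S `|` [set p]] for all sufficiently large
closed sets [S] lying in a clopen set that misses [p]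
([selects_point_over_large_sets]). Every point outside the quasicomponent of [p]
can be put into such an [S], so only the points [t] of the quasicomponent remain,
and whether [p] wins the duel of [t] and [p] over [S]. There [phi] behaves as on
a connected ordered space: it selects the first point for an order which depends
on [S], while the betweenness relation of this order does not
([admissible_betweenness]). Comparing the orders for different large [S] with
the fact that [p] is selected from the whole space shows that [p] is eventually
the first point ([eventually_wins_duels]). Hence some clopen [M] missing [p]
satisfies [phi (M `|` S) = p] for all closed [S] containing [p], and
[S |-> phi (M `|` S)], replaced by [phi S] when the value falls in [M], is a
selection that shows [p] to be selection maximal. *)

(** * Vietoris neighbourhoods and selections of sets *)

Section VietorisNeighbourhoods.
Variable X : topologicalType.
Implicit Types (S T K V W : set X) (P : set X -> Prop) (s : seq (set X)).

Definition nonempty_closed S := closed S /\ S !=set0.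

Definition meets_all S s := forall A, A \in s -> S `&` A !=set0.

(** [P] holds near [S] in the Vietoris topology. The condition [T `<=` V] is kept
apart from the finitely many open sets that [T] has to meet, since the two are
verified separately. *)
Definition vietoris_near S P := exists V s,
  [/\ open V, forall A, A \in s -> open A, S `<=` V, meets_all S s &
      forall T, nonempty_closed T -> T `<=` V -> meets_all T s -> P T].

Definition set_selection (phi : set X -> X) :=
  forall S, nonempty_closed S -> S (phi S) /\
    forall W, open W -> W (phi S) -> vietoris_near S (fun T => W (phi T)).

Lemma meets_all_subset S T s : S `<=` T -> meets_all S s -> meets_all T s.
Proof. by move=> ST + A As => /(_ A As) [x [/ST Tx Ax]]; exists x. Qed.

Lemma vietoris_near_mono S P (Q : set X -> Prop) :
  (forall T, nonempty_closed T -> P T -> Q T) ->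
  vietoris_near S P -> vietoris_near S Q.
Proof.
move=> PQ [V [s [oV os SV Ss H]]]; exists V, s; split=> // T cT TV Ts.
exact: PQ (H T cT TV Ts).
Qed.

Lemma vietoris_near_and S P (Q : set X -> Prop) :
  vietoris_near S P -> vietoris_near S Q ->
  vietoris_near S (fun T => P T /\ Q T).
Proof.
move=> [V [s [oV os SV Ss H]]] [V' [s' [oV' os' SV' Ss' H']]].
exists (V `&` V'), (s ++ s'); split.
- exact: openI.
- by move=> A; rewrite mem_cat => /orP [/os|/os'].
- by move=> x Sx; split; [exact: SV|exact: SV'].
- by move=> A; rewrite mem_cat => /orP [/Ss|/Ss'].
move=> T cT TV Ts; split.
- by apply: H => // [x /TV []//|A As]; apply: Ts; rewrite mem_cat As.
- by apply: H' => // [x /TV []//|A As]; apply: Ts; rewrite mem_cat As orbT.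
Qed.

Lemma vietoris_near_sub S V :
  open V -> S `<=` V -> vietoris_near S (fun T => T `<=` V).
Proof. by move=> oV SV; exists V, [::]. Qed.

Lemma vietoris_near_meets S V :
  open V -> S `&` V !=set0 -> vietoris_near S (fun T => T `&` V !=set0).
Proof.
move=> oV SV; exists setT, [:: V]; split=> //.
- exact: openT.
- by move=> A; rewrite inE => /eqP ->.
- by move=> A; rewrite inE => /eqP ->.
- by move=> T _ _; apply; rewrite inE.
Qed.

Lemma nonempty_closedU K T :
  closed K -> nonempty_closed T -> nonempty_closed (K `|` T).
Proof. by move=> cK [cT [x Tx]]; split; [exact: closedU|exists x; right]. Qed.

(** The open sets already met by [K] impose nothing on [T']; hence the union with
a fixed closed set is a continuous operation on the hyperspace. *)
Lemma vietoris_near_setU K T P : closed K ->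
  vietoris_near (K `|` T) P -> vietoris_near T (fun T' => P (K `|` T')).
Proof.
move=> cK [V [s [oV os KTV KTs H]]].
exists V, [seq A <- s | `[< T `&` A !=set0 >]]; split=> //.
- by move=> A; rewrite mem_filter => /andP [_ /os].
- by move=> x Tx; apply: KTV; right.
- by move=> A; rewrite mem_filter => /andP [/asboolP].
move=> T' cT' T'V T's; apply: H; first exact: nonempty_closedU.
- by move=> x [Kx|/T'V//]; apply: KTV; left.
move=> A As; have [|TA] := pselect (T `&` A !=set0).
  move=> /asboolP TA.
  have [|x [T'x Ax]] := T's A; first by rewrite mem_filter TA.
  by exists x; split=> //; right.
have [x [[Kx|Tx] Ax]] := KTs A As; first by exists x; split=> //; left.
by exfalso; apply: TA; exists x.
Qed.

Lemma filter_seq (F : set_system X) s (FF : Filter F) :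
  (forall A, A \in s -> F A) -> F (fun x => forall A, A \in s -> A x).
Proof.
elim: s => [|A s IH] H; first by apply: filterE => x A; rewrite in_nil.
have FA : F A by apply: H; rewrite mem_head.
have Fs : F (fun x => forall A, A \in s -> A x).
  by apply: IH => B Bs; apply: H; rewrite inE Bs orbT.
apply: filterS (filterI FA Fs) => x [Ax sx] B; rewrite inE => /orP [/eqP -> //|].
exact: sx.
Qed.

Lemma vietoris_near_set1 x P : vietoris_near [set x] P ->
  exists U, [/\ open U, U x & forall T, nonempty_closed T -> T `<=` U -> P T].
Proof.
move=> [V [s [oV os xV xs H]]].
have : nbhs x (V `&` (fun y => forall A, A \in s -> A y)).
  apply: filterI; first by apply: open_nbhs_nbhs; split=> //; exact: xV.
  apply: filter_seq => A As; apply: open_nbhs_nbhs; split; first exact: os.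
  by have [y [/= -> ]] := xs A As.
rewrite nbhsE => -[U [oU Ux] UV]; exists U; split=> // T cT TU.
apply: H => // [y /TU/UV []//|A As].
have [_ [y Ty]] := cT; exists y; split=> //.
by have [_] := UV y (TU y Ty); apply.
Qed.

Lemma eventually_meets_all (E : nat -> set X) s :
  (forall A, A \in s -> exists m, forall n, m <= n -> E n `&` A !=set0) ->
  exists m, forall n, m <= n -> meets_all (E n) s.
Proof.
elim: s => [|A s IH] H; first by exists 0 => n _ A; rewrite in_nil.
have [|m Hm] := IH; first by move=> B Bs; apply: H; rewrite inE Bs orbT.
have [|m' Hm'] := H A; first by rewrite mem_head.
exists (maxn m m') => n; rewrite geq_max => /andP [mn m'n] B.
by rewrite inE => /orP [/eqP ->|Bs]; [exact: Hm'|exact: Hm].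
Qed.

(** In the Vietoris topology an increasing sequence converges to the closure of
its union. *)
Lemma vietoris_near_bigcup (Q : nat -> set X) K P :
  (forall m n, m <= n -> Q m `<=` Q n) -> (forall n, closed (Q n)) ->
  nonempty_closed K ->
  vietoris_near (closure (\bigcup_n Q n) `|` K) P ->
  exists m, forall n, m <= n -> P (Q n `|` K).
Proof.
move=> Qi Qc cK [V [s [oV os SV Ss H]]].
have [|m Hm] := @eventually_meets_all (fun n => Q n `|` K) s.
  move=> A As; have [x [[clx|Kx] Ax]] := Ss A As; last first.
    by exists 0 => n _; exists x; split=> //; right.
  have [|y [[m _ Qy] Ay]] := clx A.
    by apply: open_nbhs_nbhs; split=> //; exact: os.
  by exists m => n mn; exists y; split=> //; left; exact: Qi Qy.
exists m => n mn; apply: H; [exact: nonempty_closedU| |exact: Hm].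
move=> x [Qx|Kx]; apply: SV; last by right.
by left; apply: subset_closure; exists n.
Qed.

End VietorisNeighbourhoods.

Section SetSelections.
Variables (X : topologicalType) (hX : hausdorff_space X) (phi : set X -> X).
Hypothesis phiS : set_selection phi.
Implicit Types (S T K V W G N D : set X) (s : seq X).

Lemma closed_seq s : closed [set` s].
Proof.
by have /accessible_finite_set_closed := hausdorff_accessible hX; apply.
Qed.

Lemma closed_point (x : X) : closed [set x].
Proof. by rewrite -set_cons1; exact: closed_seq. Qed.

Lemma open_separation (x y : X) : x <> y -> exists U V,
  [/\ open U, open V, U x, V y & U `&` V = set0].
Proof.
move=> xy; move: hX; rewrite open_hausdorff => /(_ x y).
case=> [|[U V] /= [xU yV] [oU oV /eqP UV]]; first exact/eqP.
by exists U, V; split=> //; rewrite -in_setE.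
Qed.

Lemma nonempty_closed1 K (x : X) : closed K -> nonempty_closed (K `|` [set x]).
Proof.
by move=> cK; apply: nonempty_closedU => //; split; [exact: closed_point|exists x].
Qed.

Lemma selection_in S : nonempty_closed S -> S (phi S).
Proof. by move=> /phiS []. Qed.

Lemma selection_near S W : nonempty_closed S -> open W -> W (phi S) ->
  vietoris_near S (fun T => W (phi T)).
Proof. by move=> /phiS [_]; exact. Qed.

Lemma selection_setU_near K T W : closed K -> nonempty_closed T ->
  open W -> W (phi (K `|` T)) ->
  vietoris_near T (fun T' => W (phi (K `|` T'))).
Proof.
move=> cK cT oW Wp; apply: (vietoris_near_setU (P := fun T => W (phi T)) cK).
by apply: selection_near => //; exact: nonempty_closedU.
Qed.

Lemma selection_setU1_near K x W : closed K ->
  open W -> W (phi (K `|` [set x])) -> exists U, [/\ open U, U x &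
    forall T, nonempty_closed T -> T `<=` U -> W (phi (K `|` T))].
Proof.
move=> cK oW Wp.
apply: (vietoris_near_set1 (P := fun T => W (phi (K `|` T)))).
apply: selection_setU_near => //.
by split; [exact: closed_point|exists x].
Qed.

Lemma add_point_continuous K :
  closed K -> continuous (fun z => phi (K `|` [set z])).
Proof.
move=> cK; apply/continuousP => W oW; rewrite openE => x Wx.
have [U [oU Ux H]] := selection_setU1_near cK oW Wx.
rewrite /interior nbhsE; exists U => // y Uy; apply: H => [|z -> //].
by split; [exact: closed_point|exists y].
Qed.

Lemma add_point_open K W :
  closed K -> open W -> open [set z | W (phi (K `|` [set z]))].
Proof. by move=> /add_point_continuous /continuousP; exact. Qed.

Lemma add_point_closed K W :
  closed K -> closed W -> closed [set z | W (phi (K `|` [set z]))].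
Proof. by move=> /add_point_continuous /continuous_closedP; exact. Qed.

Lemma add_point_clopen K G :
  closed K -> clopen G -> clopen [set z | G (phi (K `|` [set z]))].
Proof.
by move=> cK [oG cG]; split; [exact: add_point_open|exact: add_point_closed].
Qed.

Lemma add_point_id K (x : X) : K x -> K `|` [set x] = K.
Proof. by move=> Kx; apply/seteqP; split=> [y [//|->]|y]; [|left]. Qed.

Lemma add_point_new K z : closed K ->
  ~ K (phi (K `|` [set z])) -> phi (K `|` [set z]) = z.
Proof. by move=> cK; have [] := selection_in (nonempty_closed1 z cK). Qed.

(** With [add_point_rejected_open], a cut of the complement of [K] into two open
pieces, which plays the role of the two sides of a point in an ordered space. *)
Lemma add_point_selected_open K :
  closed K -> open [set z | ~ K z /\ phi (K `|` [set z]) = z].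
Proof.
move=> cK; have -> : [set z | ~ K z /\ phi (K `|` [set z]) = z] =
    [set z | (~` K) (phi (K `|` [set z]))].
  apply/seteqP; split=> z /=; first by move=> [Kz ->].
  by move=> Kp; have pz := add_point_new cK Kp; split=> //; rewrite -{1}pz.
by apply: add_point_open => //; exact: closed_openC.
Qed.

Lemma add_point_rejected_open K :
  closed K -> open [set z | ~ K z /\ phi (K `|` [set z]) <> z].
Proof.
move=> cK; rewrite openE => x [Kx px].
have Kp : K (phi (K `|` [set x])).
  by have [] := selection_in (nonempty_closed1 x cK).
have [U [V [oU oV Ux Vp UV]]] := open_separation (nesym px).
rewrite /interior nbhsE.
exists ((U `&` ~` K) `&` [set z | V (phi (K `|` [set z]))]); last first.
  move=> z [[Uz Kz] Vz]; split=> // pz; suff : set0 z by [].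
  by rewrite -UV; split=> //; rewrite -pz.
split=> //; apply: openI; last exact: add_point_open.
by apply: openI => //; exact: closed_openC.
Qed.

(** Selecting an isolated point [y] of [K] is a clopen condition on the added
point, because the added point itself stays away from [y]. *)
Lemma add_point_isolated_clopen K V y : closed K -> open V ->
  V `&` K = [set y] -> phi K <> y -> clopen [set z | phi (K `|` [set z]) = y].
Proof.
move=> cK oV VKy Ky; have [Vy Ky'] : (V `&` K) y by rewrite VKy.
split; last exact: (add_point_closed cK (closed_point (x := y))).
rewrite openE => x /= px.
have yx : y <> x by move=> yx; apply: Ky; rewrite -px -yx add_point_id.
have [U [U' [oU oU' Uy Ux UU']]] := open_separation yx.
rewrite /interior nbhsE.
exists ([set z | (V `&` U) (phi (K `|` [set z]))] `&` U'); first split.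
- by apply: openI => //; apply: add_point_open => //; exact: openI.
- by split=> //=; rewrite px.
move=> z [/= [Vz Uz] U'z].
suff : (V `&` K) (phi (K `|` [set z])) by rewrite VKy.
split=> //; have [//|pz] := selection_in (nonempty_closed1 z cK).
by exfalso; suff : set0 z by []; rewrite -UU'; split=> //; rewrite -{1}pz.
Qed.

End SetSelections.

(** * Clopen sets produced by a selection *)

Section SelectionClopen.
Variables (X : topologicalType) (hX : hausdorff_space X) (phi : set X -> X).
Hypothesis phiS : set_selection phi.
Implicit Types (S T K V W G N D : set X) (s : seq X).

Lemma finite_meets_all (A B : set X) (l : seq (set X)) :
  meets_all (A `|` B) l ->
  exists s, [set` s] `<=` B /\ meets_all (A `|` [set` s]) l.
Proof.
elim: l => [|C l IH] H; first by exists [::]; split=> // x; rewrite /= in_nil.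
have [|s [sB sl]] := IH; first by move=> D Dl; apply: H; rewrite inE Dl orbT.
have [x [ABx Cx]] := H C (mem_head _ _).
exists (if pselect (B x) then x :: s else s); split.
  case: pselect => // Bx y /=; rewrite inE => /orP [/eqP -> //|]; exact: sB.
move=> D; rewrite inE => /orP [/eqP ->|Dl].
  exists x; split=> //; case: pselect => [Bx|nBx]; last by case: ABx => //; left.
  by right; rewrite /= mem_head.
apply: (meets_all_subset _ sl) Dl => y [Ay|sy]; [by left|right].
by case: pselect => //= Bx; rewrite inE sy orbT.
Qed.

(** Finite sets are dense in the hyperspace. *)
Lemma finite_approximation (A B W : set X) :
  closed A -> A !=set0 -> closed B -> open W -> W (phi (A `|` B)) ->
  exists s, [set` s] `<=` B /\ W (phi (A `|` [set` s])).
Proof.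
move=> cA [a Aa] cB oW Wp.
have cAB : nonempty_closed (A `|` B).
  by split; [exact: closedU|exists a; left].
have [V [l [oV ol ABV ABl H]]] := selection_near phiS cAB oW Wp.
have [s [sB sl]] := finite_meets_all ABl.
exists s; split=> //; apply: H => //.
  by split; [apply: closedU => //; exact: (closed_seq hX)|exists a; left].
by move=> x [Ax|/sB Bx]; apply: ABV; [left|right].
Qed.

Lemma chain_meets_all S (F : set (set X)) (l : seq (set X)) :
  total_on F subset -> (forall A, A \in l -> open A) ->
  meets_all (S `|` closure (\bigcup_(A in F) A)) l ->
  exists B, (B = set0 \/ F B) /\ meets_all (S `|` B) l.
Proof.
move=> Ft; elim: l => [|C l IH] ol H.
  by exists set0; split; [left|move=> A; rewrite in_nil].
have [||B [FB Bl]] := IH.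
- by move=> D Dl; apply: ol; rewrite inE Dl orbT.
- by move=> D Dl; apply: H; rewrite inE Dl orbT.
have CC : C \in C :: l by rewrite mem_head.
have [x [[Sx|clx] Cx]] := H C CC.
  exists B; split=> // D; rewrite inE => /orP [/eqP ->|/Bl //].
  by exists x; split=> //; left.
have [|y [[B' FB' B'y] Cy]] := clx C.
  by apply: open_nbhs_nbhs; split=> //; exact: ol.
have [BB'|B'B] : B `<=` B' \/ B' `<=` B.
  by case: FB => [->|/Ft]; [left|exact].
- exists B'; split; first by right.
  move=> D; rewrite inE => /orP [/eqP ->|Dl].
    by exists y; split=> //; right.
  by apply: (meets_all_subset _ Bl) Dl; exact: setUS.
- exists B; split=> // D; rewrite inE => /orP [/eqP ->|/Bl //].
  by exists y; split=> //; right; exact: B'B.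
Qed.

(** A set [O] that is maximal for the property in the conclusion is open outside
[N]: adding to it any point that is close to it in the Vietoris sense keeps the
selected point in [N]. *)
Lemma clopen_extension S T N : clopen N -> nonempty_closed S -> S `<=` N ->
  closed T -> T `&` N = set0 -> N (phi (S `|` T)) ->
  exists O, [/\ clopen O, T `<=` O, O `&` N = set0 & N (phi (S `|` O))].
Proof.
move=> [oN cN] cS SN cT TN NST.
pose P A := A `&` N = set0 /\ N (phi ((S `|` T) `|` closure A)).
have cST : nonempty_closed (S `|` T) by rewrite setUC; exact: nonempty_closedU.
have nec A : nonempty_closed ((S `|` T) `|` closure A).
  by rewrite setUC; apply: nonempty_closedU => //; exact: closed_closure.
have [F FP Ft|O [[ON NO] Omax]] := @Zorn_bigcup _ P.
  split.
    apply/seteqP; split=> // x [[A FA Ax] Nx].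
    by have [<- _] := FP A FA; split.
  have [//|nN] := pselect (N (phi (S `|` T `|` closure (\bigcup_(A in F) A)))).
  exfalso; have [V [l [oV ol SV Sl H]]] :=
    selection_near phiS (nec _) (closed_openC cN) nN.
  have [B [FB Bl]] := chain_meets_all Ft ol Sl.
  have : (~` N) (phi ((S `|` T) `|` closure B)).
    apply: H => //.
      move=> x [STx|clx]; apply: SV; first by left.
      right; apply: closure_subset clx.
      by case: FB => [->//|FB] y By; exists B.
    by apply: meets_all_subset Bl; apply: setUS; exact: subset_closure.
  by case: FB => [-> []|/FP [_ NB] []//]; rewrite closure0 setU0.
pose O' := T `|` closure O.
have O'N : O' `&` N = set0.
  apply/seteqP; split=> // x [[Tx|clx] Nx]; first by rewrite -TN; split.
  have [|y] := clx N; first by apply: open_nbhs_nbhs.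
  by rewrite ON.
have SO' : S `|` O' = (S `|` T) `|` closure O by rewrite setUA.
have cO' : closed O' by apply: closedU => //; exact: closed_closure.
exists O'; split=> //; [|by left|by rewrite SO'].
split=> //; have [V [l [oV ol SV Sl H]]] := selection_near phiS (nec _) oN NO.
suff -> : O' = V `&` ~` N by apply: openI => //; exact: closed_openC.
apply/seteqP; split=> x.
  move=> O'x; split=> [|Nx]; first by apply: SV; rewrite -SO'; right.
  by suff : set0 x by []; rewrite -O'N.
move=> [Vx nNx]; right; apply: subset_closure; apply: contrapT => nOx.
apply: (Omax (O `|` [set x])).
  by rewrite properEneq; split; [apply/eqP => OO; apply: nOx; rewrite OO; right
    |exact: subsetUl].
split.
  rewrite setIUl ON set0U; apply/seteqP; split=> // y [-> //].
apply: H => //.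
  move=> y; rewrite closureU setUA => -[|]; first exact: SV.
  by have /closure_id <- := closed_point hX (x := x) => ->.
by apply: meets_all_subset Sl; apply: setUS; apply: closure_subset; left.
Qed.

(** Shrinking a finite part of [B] while the selected point stays in [G] ends
with a finite set [s] whose selected point [y] is indispensable. Then no other
point [w] of [s] satisfies [G (phi (K `|` [set w]))] for [K] the set left after
removing [y], so that the clopen set of all such [w] avoids [K]. *)
Lemma clopen_of_selected_points (A B G : set X) :
  closed A -> A !=set0 -> clopen G -> A `&` G = set0 ->
  closed B -> B `<=` G -> G (phi (A `|` B)) ->
  exists K D, [/\ closed K, A `<=` K, clopen D /\ D `<=` G, D !=set0 &
                  forall z, D z -> phi (K `|` [set z]) = z].
Proof.
move=> cA A0 cG AG cB BG GAB.
have [s [sB]] := finite_approximation cA A0 cB cG.1 GAB.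
have {sB BG} sG : [set` s] `<=` G by move=> x /sB /BG.
elim: {s}(size s) {-2}s (leqnn (size s)) sG => [|n IH] s sn sG Gs.
  move: Gs; have -> : s = [::] by move: sn; case: (s).
  rewrite set_nil setU0 => Gs; exfalso; suff : set0 (phi A) by [].
  by rewrite -AG; split=> //; exact: (selection_in phiS (conj cA A0)).
have cAs (t : seq X) : nonempty_closed (A `|` [set` t]).
  split; first by apply: closedU => //; exact: (closed_seq hX).
  by have [a Aa] := A0; exists a; left.
have ys : phi (A `|` [set` s]) \in s.
  have [Ay|//] := selection_in phiS (cAs s).
  by exfalso; suff : set0 (phi (A `|` [set` s])) by []; rewrite -AG.
set y := phi _ in ys Gs; pose t := [seq x <- s | x != y].
have tG : [set` t] `<=` G.
  by move=> x /=; rewrite mem_filter => /andP [_ /sG].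
have tsize : size t < size s.
  rewrite size_filter ltn_neqAle count_size andbT -all_count.
  by apply/allPn; exists y; rewrite //= eqxx.
have [Gt|nGt] := pselect (G (phi (A `|` [set` t]))).
  by apply: (IH t) => //; rewrite -ltnS; exact: leq_trans sn.
pose K := A `|` [set` t].
have cK : closed K by exact: (cAs t).1.
have Ky : K `|` [set y] = A `|` [set` s].
  rewrite -setUA; congr (_ `|` _); apply/seteqP; split=> x /=.
    by move=> [|-> //]; rewrite mem_filter => /andP [].
  by move=> xs; have [->|xy] := eqVneq x y; [right|left; rewrite mem_filter xy].
pose D0 := G `&` [set w | G (phi (K `|` [set w]))].
have cD0 : clopen D0 by exact: (clopenI cG (add_point_clopen hX phiS cK cG)).
have D0K w : D0 w -> ~ K w.
  by move=> [_ /= Gw] Kw; apply: nGt; move: Gw; rewrite add_point_id.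
exists K, (D0 `&` [set w | D0 (phi (K `|` [set w]))]); split=> //.
- by left.
- split; first exact: (clopenI cD0 (add_point_clopen hX phiS cK cD0)).
  by move=> w [[]].
- have D0y : D0 y by split; [exact: sG|rewrite /= Ky].
  by exists y; split; rewrite //= Ky.
move=> z [D0z /= D0p]; apply: (add_point_new hX phiS) => // Kp; exact: (D0K _ D0p).
Qed.

End SelectionClopen.

(** * Countably-approachable points and clopen sequences *)

(** The members of the sequence are the intersections of the initial segments of
an enumeration of the base. *)
Lemma decreasing_clopen_base (T : topologicalType) (p : T) :
  countable_clopen_base p -> exists E : nat -> set T,
  [/\ forall n, clopen (E n), forall n, E n p,
      forall m n, m <= n -> E n `<=` E m &
      forall W, open W -> W p -> exists n, E n `<=` W].
Proof.
move=> [B [/pcard_surjP [g gB] Bclopen Bbase]].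
pose H i := if pselect (B (g i)) then g i else setT.
have HP i : clopen (H i) /\ H i p.
  by rewrite /H; case: pselect => [b|nb] /=; [exact: Bclopen|split=> //; exact: clopenT].
pose E n := [set x | forall i, i <= n -> H i x].
have ES n : E n.+1 = E n `&` H n.+1.
  apply/seteqP; split=> x; first by move=> Ex; split=> [i /leqW /Ex//|]; exact: Ex.
  by move=> [Ex Hx] i; rewrite leq_eqVlt => /orP [/eqP -> //|/Ex].
exists E; split.
- elim=> [|n IH]; last by rewrite ES; apply: clopenI => //; exact: (HP _).1.
  suff -> : E 0 = H 0 by exact: (HP _).1.
  by apply/seteqP; split=> [x /(_ 0)|x Hx i]; [exact|rewrite leqn0 => /eqP ->].
- by move=> n i _; exact: (HP i).2.
- by move=> m n mn x Ex i im; apply: Ex; exact: leq_trans mn.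
move=> W oW Wp; have [|A BA AW] := Bbase W; first exact: open_nbhs_nbhs.
have [i _ giA] := gB A BA; exists i => x /(_ i (leqnn i)).
by rewrite /H giA; case: pselect => //= b /AW.
Qed.

Lemma countable_clopen_base_seq (T : topologicalType) (p : T) (E : nat -> set T) :
  (forall n, clopen (E n)) -> (forall n, E n p) ->
  (forall W, open W -> W p -> exists n, E n `<=` W) -> countable_clopen_base p.
Proof.
move=> cE Ep Eb; exists (range E); split.
- exact: (card_image_le E setT).
- by move=> _ [n _ <-].
- move=> N; rewrite nbhsE => -[W [oW Wp] WN].
  by have [n EW] := Eb W oW Wp; exists (E n); [exists n|exact: subset_trans WN].
Qed.

Lemma isolated_open1 (T : topologicalType) (p : T) :
  isolated setT p <-> open [set p].
Proof.
split=> [[_ [V Vp]]|op].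
  rewrite setIT => VE; rewrite openE => _ ->; rewrite /interior -VE.
  by rewrite VE in Vp *.
split; first exact: mem_set.
by exists [set p]; [exact: open_nbhs_nbhs|exact: setIT].
Qed.

(** The form in which approachability is used: the closure of the approaching
open set, without [p], is made of clopen pieces converging to [p]. *)
Definition clopen_approach (X : topologicalType) (p : X) (D : nat -> set X) :=
  (forall n, [/\ clopen (D n), D n !=set0 & ~ D n p]) /\
  (forall W, open W -> W p -> exists m, forall n, m <= n -> D n `<=` W).

Section Approach.
Variables (X : topologicalType) (hX : hausdorff_space X) (p : X).

Lemma subtype_clopen (U R : set X) :
  clopen R -> clopen (set_val @^-1` R : set U).
Proof.
move=> [oR cR]; split; first by exists R.
by rewrite -openC; exists (~` R) => //; exact: closed_openC.
Qed.

(** The approaching open set is the union of the [D n]; its closure adds only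
[p], and leaving out finitely many of the [D n] gives the clopen base. *)
Lemma clopen_approach_approachable (D : nat -> set X) :
  clopen_approach p D -> countably_approachable p.
Proof.
move=> [DP Dp]; right; pose U := \bigcup_n D n.
pose R n := [set x | forall k, k < n -> ~ D k x].
have cR n : clopen (R n).
  elim: n => [|n IH].
    by suff -> : R 0 = setT by [exact: clopenT]; apply/seteqP; split.
  have -> : R n.+1 = R n `&` ~` D n.
    apply/seteqP; split=> x; last first.
      by move=> [Rx Dx] k; rewrite ltnS leq_eqVlt => /orP [/eqP ->|/Rx].
    by move=> Rx; split=> [k kn|]; apply: Rx => //; exact: ltnW.
  by have [cD _ _] := DP n; exact: clopenI IH (clopenC set0 cD).
have Rp n : R n p by move=> k _; have [] := DP k.
have clU : closure U = U `|` [set p].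
  apply/seteqP; split=> x.
    move=> clx; apply: contrapT => /not_orP [nUx /= xp].
    have [A [A' [oA oA' Ax A'p AA']]] := open_separation hX xp.
    have [m mD] := Dp A' oA' A'p.
    have [|y [[k _ Dy] [Ay Ry]]] := clx (A `&` R m).
      apply: open_nbhs_nbhs; split; first exact: openI oA (cR m).1.
      by split=> // k _ Dx; apply: nUx; exists k.
    have [km|mk] := ltnP k m; first exact: Ry km Dy.
    by suff : set0 y by []; rewrite -AA'; split=> //; exact: mD mk _ Dy.
  move=> [Ux|->]; first exact: subset_closure.
  move=> N; rewrite nbhsE => -[W [oW Wp] WN].
  have [m mD] := Dp W oW Wp; have [_ [y Dy] _] := DP m.
  by exists y; split; [exists m|apply: WN; exact: mD Dy].
exists U; split=> //.
- by apply: bigcup_open => k _; have [[]] := DP k.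
- by move=> x [k _ Dx] xp; have [_ _] := DP k; rewrite -xp.
have pU : p \in closure U by rewrite clU inE; right.
exists (exist _ p pU) => //.
apply: (countable_clopen_base_seq (E := fun n => set_val @^-1` R n)).
- by move=> n; exact: subtype_clopen.
- by move=> n; exact: Rp.
move=> _ [W oW <-] Wp; have [m mD] := Dp W oW Wp.
exists m => -[x xU] Rx; have : (U `|` [set p]) x by rewrite -clU -in_setE.
case=> [[k _ Dx]|/= xp]; last first.
  by move: Wp; rewrite /preimage /= !set_valE /= xp.
have [km|mk] := ltnP k m; first by exfalso; exact: Rx km Dx.
exact: mD mk _ Dx.
Qed.

(** The differences of the members of a decreasing clopen base of [p] in the
closure of [U] are clopen in the whole space. *)
Lemma approachable_clopen_approach :
  countably_approachable p -> ~ open [set p] ->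
  exists D, clopen_approach p D.
Proof.
move=> [/isolated_open1 //|[U [oU Up clU [q qp bq]]]] _.
have [E [cE Eq Ei Eb]] := decreasing_clopen_base bq.
have vq : set_val q = p by rewrite set_valE.
have next n : exists m, E n `\` E m !=set0.
  have [[W oW EW] _] := cE n.
  have Wp : W p by have := Eq n; rewrite -EW /preimage /= vq.
  have : closure U p by rewrite clU; right.
  move=> /(_ W) [|x [Ux Wx]]; first exact: open_nbhs_nbhs.
  have xU : x \in closure U by rewrite inE; exact: subset_closure.
  have [||m Em] := Eb (set_val @^-1` (~` [set x])).
  - by exists (~` [set x]) => //; apply: closed_openC; exact: closed_point.
  - by rewrite /preimage /= vq => px; apply: (Up x Ux).
  exists m, (exist _ x xU); split; first by rewrite -EW.
  by move=> /Em; apply.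
pose m n := projT1 (cid (next n)).
pose D n := [set set_val x | x in E n `\` E (m n)].
have Dclosure n : D n `<=` closure U.
  by move=> _ [[x xU] _ <-]; exact: set_mem xU.
have preD n W : set_val @^-1` W = E n `\` E (m n) -> D n = W `&` closure U.
  move=> WE; apply/seteqP; split=> x.
    by move=> Dx; split; [case: Dx => y; rewrite -WE => Wy <-|exact: Dclosure Dx].
  move=> [Wx /mem_set xU]; exists (exist _ x xU) => //.
  by rewrite -WE.
have Dnp n : ~ D n p.
  move=> [x [_ nEx] xp]; apply: nEx; suff -> : x = q by exact: Eq.
  by apply: val_inj; rewrite -[LHS]/(set_val x) xp.
have DU n : D n `<=` U.
  by move=> x Dx; have := Dclosure n x Dx; rewrite clU => -[//|/= xp];
    exfalso; apply: (@Dnp n); rewrite -xp.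
have cDE n : clopen (E n `\` E (m n)).
  by rewrite setDE; exact: clopenI (cE _) (clopenC set0 (cE _)).
exists D; split=> [n|W oW Wp].
  split=> //; last by case: (projT2 (cid (next n))) => x Ex; exists (set_val x); exists x.
  split.
    have [[W oW WE] _] := cDE n.
    suff -> : D n = W `&` U by exact: openI.
    apply/seteqP; split=> x; last first.
      by move=> [Wx Ux]; rewrite (preD _ _ WE); split=> //; exact: subset_closure.
    by move=> Dx; split; [move: Dx; rewrite (preD _ _ WE) => -[]|exact: DU Dx].
  have [_] := cDE n; rewrite -openC => -[W oW WE].
  rewrite (preD n (~` W)); last by rewrite -[RHS]setCK -WE.
  by apply: closedI; [exact: open_closedC|exact: closed_closure].
have [||k Ek] := Eb (set_val @^-1` W); [by exists W|by rewrite /preimage /= vq|].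
exists k => n kn _ [x [Ex _] <-]; apply: Ek; exact: Ei kn _ Ex.
Qed.

End Approach.

(** * Selection maximality at countably-approachable points *)

Lemma choice_sequence (T : Type) (P : T -> Prop) (R : nat -> T -> T -> Prop) x0 :
  P x0 -> (forall n x, P x -> exists y, P y /\ R n x y) ->
  exists f : nat -> T, f 0 = x0 /\ forall n, P (f n) /\ R n (f n) (f n.+1).
Proof.
move=> P0 step.
have [g gP] : {g : nat * T -> T &
    forall a, P a.2 -> P (g a) /\ R a.1 a.2 (g a)}.
  apply: (@choice _ _ (fun a y => P a.2 -> P y /\ R a.1 a.2 y)) => -[n x] /=.
  have [/(step n) [y yP]|nP] := pselect (P x).
    by exists y.
  by exists x.
pose f := fix f n := if n is k.+1 then g (k, f k) else x0.
exists f; split=> //.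
have Pf n : P (f n) by elim: n => // n IH; exact: (gP (n, f n) IH).1.
by move=> n; split=> //; exact: (gP (n, f n) (Pf n)).2.
Qed.

Section Maximality.
Variables (X : topologicalType) (hX : hausdorff_space X) (phi : set X -> X).
Hypothesis phiS : set_selection phi.
Variable p : X.
Implicit Types (S T K V W G N : set X).

Lemma vietoris_near_setI S U (P : set X -> Prop) : clopen U -> S `&` U !=set0 ->
  vietoris_near (S `&` U) P -> vietoris_near S (fun T => P (T `&` U)).
Proof.
move=> [oU cU] SU [V [s [oV os SV Ss H]]].
exists (V `|` ~` U), (U :: [seq A `&` U | A <- s]); split.
- by apply: openU => //; exact: closed_openC.
- move=> A; rewrite in_cons => /orP [/eqP -> //|/mapP [B Bs ->]].
  by apply: openI => //; exact: os.
- by move=> x Sx; have [Ux|nUx] := pselect (U x); [left; exact: SV|right].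
- move=> A; rewrite in_cons => /orP [/eqP -> //|/mapP [B Bs ->]].
  by have [x [[Sx Ux] Bx]] := Ss B Bs; exists x.
move=> T [cT _] TV Ts; apply: H.
- by split; [exact: closedI|apply: Ts; rewrite mem_head].
- by move=> x [/TV []].
- move=> B Bs; have [|x [Tx [Bx Ux]]] := Ts (B `&` U); last by exists x.
  by rewrite in_cons; apply/orP; right; apply/mapP; exists B.
Qed.

(** A countable clopen base at [p] allows restricting a closed set missing [p]
to the smallest member of the base that it meets; selecting from this part only
brings the selected point close to [p] whenever the closed set comes close
to [p]. *)
Lemma countable_clopen_base_maximal : countable_clopen_base p ->
  exists psi, set_selection psi /\
    forall S, nonempty_closed S -> S p -> psi S = p.
Proof.
move=> /decreasing_clopen_base [E [cE Ep Ei Eb]].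
pose U n := if n is k.+1 then E k else setT.
have cU n : clopen (U n) by case: n => [|n] /=; [exact: clopenT|exact: cE].
have Up n : U n p by case: n.
have Ui m n : m <= n -> U n `<=` U m.
  by case: m n => [|m] [|n] //= mn x //; exact: Ei.
pose level S n := S `&` U n !=set0 /\ S `&` U n.+1 = set0.
have level_uniq S m n : level S m -> level S n -> m = n.
  wlog mn : m n / m <= n => [H Sm Sn|].
    by have [|/ltnW] := leqP m n => mn; [exact: H|apply/esym; exact: H].
  move=> [_ Sm] [[x [Sx Ux]] _]; apply/eqP; rewrite eqn_leq mn leqNgt.
  by apply/negP => mn'; suff : set0 x by []; rewrite -Sm; split=> //; exact: Ui Ux.
have level_ex S : nonempty_closed S -> ~ S p -> exists n, level S n.
  move=> [cS [x Sx]] nSp; have [n En] := Eb _ (closed_openC cS) nSp.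
  have ex : exists n, `[< S `&` U n = set0 >].
    exists n.+1; apply/asboolP; apply/seteqP; split=> // y [Sy Ey].
    exact: (En y Ey).
  case: (ex_minnP ex) => -[|k] /asboolP Uk kmin.
    by exfalso; suff : set0 x by []; rewrite -Uk.
  exists k; split=> //; apply/set0P; apply/eqP => Uk0.
  by have := kmin k; rewrite ltnn => /(_ (asboolT Uk0)).
pose psi S := if pselect (S p) then p else phi (S `&` U (xget 0 (level S))).
have psip S : S p -> psi S = p by move=> Sp; rewrite /psi; case: pselect.
have psilevel S n : ~ S p -> level S n -> psi S = phi (S `&` U n).
  move=> Sp Sn; rewrite /psi; case: pselect => //= _.
  by rewrite (level_uniq _ _ _ (xgetI 0 Sn) Sn).
have nelevel S n : nonempty_closed S -> level S n ->
    nonempty_closed (S `&` U n).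
  by move=> [cS _] [SU _]; split=> //; apply: closedI => //; exact: (cU n).2.
exists psi; split=> [|S _ /psip //] S cS.
have [Sp|nSp] := pselect (S p).
  rewrite psip //; split=> // W oW Wp; have [k EW] := Eb W oW Wp.
  apply: vietoris_near_mono (vietoris_near_meets (cE k).1 (S := S) _); last first.
    by exists p.
  move=> T cT TE; have [Tp|nTp] := pselect (T p); first by rewrite psip.
  have [n Tn] := level_ex T cT nTp; rewrite (psilevel _ n) //; apply: EW.
  have [_ Uphi] := selection_in phiS (nelevel _ _ cT Tn).
  apply: (Ui k.+1 n) Uphi; rewrite ltnNge; apply/negP => nk.
  have [x [Tx Ex]] := TE; have [_ Tn0] := Tn.
  by suff : set0 x by []; rewrite -Tn0; split=> //; exact: (Ui n.+1 k.+1) Ex.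
have [n Sn] := level_ex S cS nSp; rewrite (psilevel _ n) //.
have cSn := nelevel _ _ cS Sn; split; first by have [] := selection_in phiS cSn.
move=> W oW Wphi; have SnU : S `<=` ~` U n.+1.
  by move=> x Sx Ux; have [_ Sn0] := Sn; suff : set0 x by []; rewrite -Sn0.
have := vietoris_near_and (vietoris_near_meets (cU n).1 Sn.1)
  (vietoris_near_sub (closed_openC (cU n.+1).2) SnU).
move=> /(vietoris_near_and (vietoris_near_setI (cU n) Sn.1
  (selection_near phiS cSn oW Wphi))).
apply: vietoris_near_mono => T cT [WT [TU TnU]].
rewrite (psilevel _ n) //; first by move=> Tp; exact: (TnU p Tp).
by split=> //; apply/seteqP; split=> // x [/TnU].
Qed.

(** Sets that eventually meet every nonempty open set converge to the whole
space. *)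
Lemma selection_near_setT (E : nat -> set X) W :
  open W -> W (phi setT) ->
  (forall A, open A -> A !=set0 ->
    exists m, forall n, m <= n -> E n `&` A !=set0) ->
  exists m, forall n, m <= n ->
    forall T, nonempty_closed T -> E n `<=` T -> W (phi T).
Proof.
move=> oW Wp HE.
have cT : nonempty_closed [set: X] by split; [exact: closedT|exists p].
have [V [s [oV os SV Ss H]]] := selection_near phiS cT oW Wp.
have [|m Hm] := @eventually_meets_all _ E s.
  by move=> A As; apply: HE; [exact: os|have [x []] := Ss A As; exists x].
exists m => n /Hm Es T cT' ET; apply: H => //; last exact: meets_all_subset Es.
by move=> x _; exact: SV.
Qed.

Section ApproachableMaximal.
Hypothesis phimax : forall S, nonempty_closed S -> S p -> phi S = p.
Variable D : nat -> set X.
Hypothesis Dp : clopen_approach p D.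

(** The sets [D n `|` F] converge to [F `|` [set p]], from which [p] is selected;
so the points selected from them eventually leave [F]. *)
Lemma approach_selected F : closed F -> ~ F p ->
  exists n, D n `&` F = set0 /\ D n (phi (D n `|` F)).
Proof.
move=> cF nFp; have [DP Dlim] := Dp.
have [|U [oU Ux HU]] :=
  selection_setU1_near hX phiS (x := p) cF (closed_openC cF).
  by rewrite phimax //; [exact: nonempty_closed1|right].
have [m HD] := Dlim (U `&` ~` F) (openI oU (closed_openC cF)) (conj Ux nFp).
have [[_ cD] D0 _] := DP m.
exists m; split.
  by apply/seteqP; split=> // x [/(HD m (leqnn m)) [_ nF] Fx].
have nF := HU (D m) (conj cD D0) (fun x Dx => (HD m (leqnn m) x Dx).1).
rewrite setUC; by have [] := selection_in phiS (nonempty_closedU cF (conj cD D0)).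
Qed.

(** A closed set missing [p] extends to a clopen one, still leaving the selected
point in some [D n]; this prevents it from containing [p]. *)
Lemma maximal_clopen_base W : open W -> W p ->
  exists O, [/\ clopen O, O p & O `<=` W].
Proof.
move=> oW Wp; have [|n [DW Dphi]] := approach_selected (open_closedC oW).
  by move=> /(_ Wp).
have [cD D0 nDp] := Dp.1 n.
have [|O [cO WO OD DO]] := clopen_extension hX phiS cD (conj cD.2 D0)
  (@subset_refl _ _) (open_closedC oW) _ Dphi; first by rewrite setIC.
exists (~` O); split; first exact: clopenC set0 cO.
  move=> Op; apply: nDp; rewrite phimax // in DO; last by right.
  by rewrite setUC; apply: nonempty_closedU; [exact: cO.2|split=> //; exact: cD.2].
by move=> x nOx; apply: contrapT => nWx; apply: nOx; exact: WO.
Qed.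

Lemma approach_not_open1 : ~ open [set p].
Proof.
move=> op; have [m Hm] := Dp.2 _ op erefl.
have [_ [x Dx] nDp] := Dp.1 m; apply: nDp.
by have <- := Hm m (leqnn m) x Dx.
Qed.

(** The clopen neighbourhoods [O n] are chosen so that they shrink to [p] and
that from [~` O n `|` T] with [T] inside [O n.+1] a point of [T] is selected.
If a closed [F] missing [p] met all of them, the sets
[~` O n `|` (F `&` O n.+1)] would converge to the whole space, whose selected
point is [p], although the points selected from them lie in [F]. *)
Lemma maximal_countable_clopen_base : countable_clopen_base p.
Proof.
pose P O := clopen O /\ O p.
pose R n (O O' : set X) := [/\ O' `<=` O,
  forall x, O' x -> ~ D n x /\ ~ D n (phi (D n `|` [set x])) &
  forall T, nonempty_closed T -> T `<=` O' -> T (phi (~` O `|` T))].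
have [||O [O0 OP]] := @choice_sequence _ P R setT.
- by split=> //; exact: clopenT.
- move=> n O [cO Op]; have [[oD cD] D0 nDp] := Dp.1 n.
  have cnO : closed (~` O) by exact: open_closedC cO.1.
  have [|U [oU Ux HU]] := selection_setU1_near hX phiS (x := p) cnO cO.1.
    by rewrite phimax //; [exact: nonempty_closed1|right].
  pose V := (~` D n) `&` [set x | (~` D n) (phi (D n `|` [set x]))].
  have cV : clopen V.
    have cDn : clopen (~` D n) by exact: clopenC set0 (conj oD cD).
    exact: clopenI cDn (add_point_clopen hX phiS cD cDn).
  have Vp : V p.
    by split=> //=; rewrite phimax //; [exact: nonempty_closed1|right].
  have [||O' [cO' O'p O'V]] := @maximal_clopen_base ((U `&` O) `&` V).
  + by apply: openI; [apply: openI => //; exact: cO.1|exact: cV.1].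
  + by [].
  exists O'; split=> //; split; first by move=> x /O'V [[]].
    by move=> x /O'V [].
  move=> T cT TO'; have [nO|//] := selection_in phiS (nonempty_closedU cnO cT).
  exfalso; apply: nO; apply: HU => // x /TO' /O'V [[]] //.
have cO n : clopen (O n) by have [[]] := OP n.
have Oi m n : m <= n -> O n `<=` O m.
  move=> /subnK <-; elim: (n - m) => [//|k IH] x; rewrite addSn => Ox.
  by apply: IH; have [_ [OO _ _]] := OP (k + m); exact: OO.
apply: (countable_clopen_base_seq cO); first by move=> n; have [[]] := OP n.
move=> W oW Wp; apply: contrapT => /forallNP nW.
pose F := ~` W.
have cF : closed F by exact: open_closedC.
have cT n : nonempty_closed (F `&` O n.+1).
  split; first by apply: closedI => //; exact: (cO _).2.
  apply: contrapT => nFO; apply: (nW n.+1) => x Ox; apply: contrapT => nWx.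
  by apply: nFO; exists x.
have [||m Hm] := @selection_near_setT (fun n => ~` O n) W oW.
- by rewrite phimax //; split; [exact: closedT|exists p].
- move=> A oA [x0 Ax0].
  have [x [Ax xp]] : exists x, A x /\ x <> p.
    apply: contrapT => nx; apply: approach_not_open1; suff <- : A = [set p] by [].
    have Ap x : A x -> x = p by move=> Ax; apply: contrapT => ?; apply: nx; exists x.
    by apply/seteqP; split=> [x /Ap //|_ ->]; rewrite -(Ap x0 Ax0).
  have [|n [_ Dn]] := approach_selected (closed_point hX (x := x)); first exact: nesym.
  exists n.+1 => k nk; exists x; split=> // Ok.
  have [_ [_ H _]] := OP n; have [_] := H x (Oi _ _ nk x Ok); exact.
have [_ [_ _ H]] := OP m.
have [nWphi _] := H _ (cT m) (fun x FO => FO.2); apply: nWphi.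
apply: (Hm m) => //; apply: nonempty_closedU => //.
by apply: open_closedC; exact: (cO m).1.
Qed.

End ApproachableMaximal.

End Maximality.

(** * Selection maximality at points that are not countably-approachable *)

Lemma setU_seq_cons (T : choiceType) (Q B : set T) (y : T) (s : seq T) :
  Q `|` [set` y :: s] `|` B = Q `|` [set` s] `|` B `|` [set y].
Proof.
have -> : [set` y :: s] = [set` s] `|` [set y].
  apply/seteqP; split=> z /=; rewrite inE.
    by case/predU1P => [->|]; [right|left].
  by move=> [->|->]; rewrite ?eqxx ?orbT.
by rewrite setUA setUAC.
Qed.

Section NotApproachable.
Variables (X : topologicalType) (hX : hausdorff_space X) (phi : set X -> X).
Hypothesis phiS : set_selection phi.
Variable p : X.
Hypothesis phiT : phi setT = p.
Hypothesis nap : ~ countably_approachable p.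
Implicit Types (S T K V W G M N Q : set X) (s t : seq X).

(** Otherwise clopen sets [M n] missing [p] and closed sets [S n] with
[M n `<=` S n `<=` M n.+1] can be found such that the point selected from
[S n `|` ~` M n.+1] is in [M n.+1]. These sets converge to the whole space, so
the selected points converge to [phi setT = p] and leave each [M m]. The
selection then provides, between the [M m]'s, nonempty clopen sets of selected
points, and these too converge to [p]. *)
Lemma selects_point_over_large_sets : exists M, [/\ clopen M, ~ M p &
  forall S N, closed S -> clopen N -> ~ N p -> M `<=` S -> S `<=` N ->
    phi (S `|` [set p]) = p].
Proof.
apply: contrapT => /forallNP nM; apply: nap.
pose P M := clopen M /\ ~ M p.
pose R (_ : nat) M M' := exists S N, [/\ closed S, clopen N, M `<=` S /\ S `<=` N,
  N `<=` M' & N (phi (S `|` ~` M'))].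
have [||M [_ MP]] := @choice_sequence _ P R set0.
- by split=> //; exact: clopen0.
- move=> n M [cM nMp]; apply: contrapT => /forallNP nM'; apply: (nM M).
  split=> // S N cS cN nNp MS SN; apply: contrapT => phip.
  have Sphi : S (phi (S `|` [set p])).
    by have [] := selection_in phiS (nonempty_closed1 hX p cS).
  have [|O [cO pO ON NO]] := clopen_extension hX phiS cN
    (conj cS (ex_intro _ _ Sphi)) SN (closed_point hX (x := p)) _ (SN _ Sphi).
    by apply/seteqP; split=> // x [/= -> /nNp].
  apply: (nM' (~` O)); split.
    by split; [exact: clopenC set0 cO|apply; exact: pO].
  exists S, N; split=> //; last by rewrite setCK.
  by move=> x Nx Ox; suff : set0 x by []; rewrite -ON.
have cM n : clopen (M n) by have [[]] := MP n.
have nMp n : ~ M n p by have [[]] := MP n.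
have Mi m n : m <= n -> M m `<=` M n.
  move=> /subnK <-; elim: (n - m) => [//|k IH] x /IH; rewrite addSn => Mx.
  have [_ [S [N [_ _ [MS SN] NM _]]]] := MP (k + m).
  by apply: NM; apply: SN; exact: MS.
have conv (n : nat -> nat) W : (forall m, m <= n m) -> open W -> W p ->
    exists m0, forall m, m0 <= m -> forall T, nonempty_closed T ->
      M m `|` ~` M (n m).+1 `<=` T -> W (phi T).
  move=> nm oW Wp.
  apply: (selection_near_setT phiS p (E := fun m => M m `|` ~` M (n m).+1) oW).
    by rewrite phiT.
  move=> A oA [x Ax]; have [[k Mx]|nMx] := pselect (exists k, M k x).
    by exists k => m km; exists x; split=> //; left; exact: Mi Mx.
  by exists 0 => m _; exists x; split=> //; right => Mx; apply: nMx; exists (n m).+1.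
have step m : exists nD : nat * set X, [/\ m <= nD.1,
    [/\ clopen nD.2, nD.2 !=set0 & ~ nD.2 p] &
    forall z, nD.2 z -> exists2 T, nonempty_closed T /\
      M m `|` ~` M nD.1.+1 `<=` T & phi T = z].
  have [|n0 Hn0] := conv id (~` M m) (fun=> leqnn _) (closed_openC (cM m).2).
    exact: nMp.
  pose n := maxn m n0.
  have [_ [S [N [cS cN [MS SN] NM Nphi]]]] := MP n.
  have MmS : M m `<=` S.
    by apply: subset_trans MS; apply: Mi; exact: leq_maxl.
  have cnM : clopen (~` M m) by exact: clopenC set0 (cM m).
  have cnM' : clopen (~` M n.+1) by exact: clopenC set0 (cM n.+1).
  have nMphi : ~ M m (phi (S `|` ~` M n.+1)).
    apply: (Hn0 n (leq_maxr _ _)) => [|x [/MS|]]; [|by left|by right].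
    by apply: nonempty_closedU => //; split; [exact: cnM'.2|exists p; exact: nMp].
  have eqS : (M m `|` ~` M n.+1) `|` (S `&` ~` M m) = S `|` ~` M n.+1.
    apply/seteqP; split=> x.
      by move=> [[/MmS|]|[]]; [left|right|left].
    move=> [Sx|]; last by left; right.
    by have [Mx|nMx] := pselect (M m x); [left; left|right].
  have [|||||||K [D [cK AK [cD DG] D0 KD]]] := clopen_of_selected_points hX phiS
    (A := M m `|` ~` M n.+1) (B := S `&` ~` M m) (G := N `&` ~` M m).
  - by apply: closedU; [exact: (cM m).2|exact: cnM'.2].
  - by exists p; right; exact: nMp.
  - exact: clopenI.
  - by apply/seteqP; split=> // x [[Mx [_ /(_ Mx)]|nMx [/NM /nMx]]].
  - by apply: closedI => //; exact: cnM.2.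
  - by move=> x [/SN].
  - by rewrite eqS.
  exists (n, D) => /=; split; first exact: leq_maxl.
    by split=> // /DG [/NM /nMp].
  move=> z Dz; exists (K `|` [set z]); last exact: KD.
  by split; [exact: nonempty_closed1|move=> x /AK; left].
have [nD nDP] := choice step.
apply: (clopen_approach_approachable hX (D := fun m => (nD m).2)).
split=> [m|W oW Wp]; first by have [] := nDP m.
have [|m0 Hm0] := conv (fun m => (nD m).1) W _ oW Wp.
  by move=> m; have [] := nDP m.
exists m0 => m m0m z Dz; have [_ _ H] := nDP m.
by have [T [cT MT] <-] := H z Dz; exact: Hm0 m0m T cT MT.
Qed.

Variable Ms : set X.
Hypothesis MsP : forall S N, closed S -> clopen N -> ~ N p ->
  Ms `<=` S -> S `<=` N -> phi (S `|` [set p]) = p.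

(** Since complements of clopen sets are clopen, this is the intersection of the
clopen neighbourhoods of [p]. *)
Definition quasicomponent : set X :=
  [set x | forall N, clopen N -> N x -> N p].

(** The closed sets [Q] over which [p] is known to be selected, together with a
clopen set witnessing that [Q] stays away from the quasicomponent of [p]. *)
Definition admissible Q N :=
  [/\ closed Q, clopen N, ~ N p, Ms `<=` Q & Q `<=` N].

Lemma quasicomponentE N x : clopen N -> quasicomponent x -> N x <-> N p.
Proof.
move=> cN Cx; split=> [|Np]; first exact: Cx.
apply: contrapT => nNx; exact: (Cx (~` N) (clopenC set0 cN) nNx) Np.
Qed.

Lemma quasicomponent_self : quasicomponent p. Proof. by []. Qed.

Lemma admissible_notin Q N x : admissible Q N -> quasicomponent x -> ~ N x.
Proof. by move=> [_ cN nNp _ _] Cx /(Cx _ cN). Qed.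

(** Points of the quasicomponent of [p] may be moved to [p] without affecting
the clopen condition [N]. *)
Lemma admissible_selects_finite Q N s x : admissible Q N ->
  [set` s] `<=` quasicomponent -> quasicomponent x ->
  ~ N (phi (Q `|` [set` s] `|` [set x])).
Proof.
move=> [cQ cN nNp MQ QN] sC Cx.
have cnN : clopen (~` N) by exact: clopenC set0 cN.
have cQs t : closed (Q `|` [set` t]) by apply: closedU => //; exact: closed_seq.
have base : (~` N) (phi (Q `|` [set` s] `|` [set p])).
  elim: s sC => [|y s IH] sC.
    by rewrite set_nil setU0 (MsP cQ cN nNp MQ QN).
  have cK : closed (Q `|` [set` s] `|` [set p]).
    by apply: closedU; [exact: cQs|exact: closed_point].
  have := quasicomponentE (add_point_clopen hX phiS cK cnN) (sC y (mem_head _ _)).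
  rewrite /= (add_point_id (K := Q `|` [set` s] `|` [set p]) (x := p)); last by right.
  rewrite setU_seq_cons => -[_]; apply; apply: IH => z zs; apply: sC.
  by rewrite /= inE zs orbT.
have /= := quasicomponentE (add_point_clopen hX phiS (cQs s) cnN) Cx.
by move=> [_]; exact.
Qed.

Lemma admissible_selects_pair Q N x y : admissible Q N ->
  quasicomponent x -> quasicomponent y ->
  phi (Q `|` [set x] `|` [set y]) = x \/ phi (Q `|` [set x] `|` [set y]) = y.
Proof.
move=> aQ Cx Cy; have [cQ _ _ _ QN] := aQ.
have xC : [set` [:: x]] `<=` quasicomponent.
  by move=> z /=; rewrite inE => /eqP ->.
have := admissible_selects_finite aQ xC Cy; rewrite set_cons1 => nN.
have [[/QN /nN //|?]|?] := selection_in phiS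
  (nonempty_closed1 hX y (closedU cQ (closed_point hX (x := x)))); [by left|by right].
Qed.

(** A point selected from [Q] together with finitely many points of the
quasicomponent wins every duel against one of them: by connectedness, removing
the other points one by one does not change the winner. *)
Lemma admissible_selects_first Q N s x y : admissible Q N ->
  [set` s] `<=` quasicomponent -> quasicomponent x -> quasicomponent y ->
  phi (Q `|` [set` s] `|` ([set x] `|` [set y])) = y ->
  phi (Q `|` [set x] `|` [set y]) = y.
Proof.
move=> aQ + Cx Cy; have [cQ cN nNp MQ QN] := aQ.
elim: s => [|t s IH] sC; first by rewrite set_nil setU0 setUA.
have {}IH := IH (fun z zs => sC z (mem_behead (s := t :: s) zs)).
rewrite setU_seq_cons => phity.
pose K := Q `|` [set` s] `|` ([set x] `|` [set y]).
rewrite -/K in IH phity.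
have [/IH //|Ky] := pselect (phi K = y).
exfalso; pose s' := [seq z <- x :: s | z != y].
have oV : open (~` (Q `|` [set` s'])).
  by apply: closed_openC; apply: closedU => //; exact: closed_seq.
have VK : ~` (Q `|` [set` s']) `&` K = [set y].
  apply/seteqP; split=> z.
    move=> [/not_orP [nQ /= ns']] [[//|sz]|[zx|//]]; apply: contrapT => /eqP zy.
      by apply: ns'; rewrite mem_filter zy inE (sz : z \in s) orbT.
    by apply: ns'; rewrite mem_filter zy /= (zx : z = x) mem_head.
  move=> ->; split; last by right; right.
  move=> [/QN|/=]; first exact: admissible_notin aQ Cy.
  by rewrite mem_filter eqxx.
have cK : closed K.
  apply: closedU; first by apply: closedU => //; exact: closed_seq.
  by apply: closedU; exact: closed_point.
have cY := add_point_isolated_clopen hX phiS cK oV VK Ky.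
have Cp := sC t (mem_head _ _) _ cY phity.
have [_ /(_ Cp) /=] := quasicomponentE cY Cx.
by rewrite add_point_id //; right; left.
Qed.

(** Two cuts of the complement of [N], at [a] and at [b], each of which has the
other cut point in its lower part, have lower parts with a clopen union. *)
Lemma clopen_setU_cuts N (U1 V1 U2 V2 : set X) a b : clopen N ->
  open U1 -> open V1 -> U1 `&` V1 = set0 ->
  open U2 -> open V2 -> U2 `&` V2 = set0 ->
  (forall z, ~ N z -> z <> b -> U1 z \/ V1 z) ->
  (forall z, ~ N z -> z <> a -> U2 z \/ V2 z) ->
  U1 a -> U2 b -> clopen (~` N `&` (U1 `|` U2)).
Proof.
move=> [oN cN] oU1 oV1 UV1 oU2 oV2 UV2 H1 H2 U1a U2b; split.
  by apply: openI; [exact: closed_openC|exact: openU].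
rewrite -openC; suff -> : ~` (~` N `&` (U1 `|` U2)) = N `|` (V1 `&` V2).
  by apply: openU => //; exact: openI.
apply/seteqP; split=> z.
  move=> H; have [|nN] := pselect (N z); first by left.
  have nU1 : ~ U1 z by move=> U1z; apply: H; split=> //; left.
  have nU2 : ~ U2 z by move=> U2z; apply: H; split=> //; right.
  right; split.
    by have [zb|//|//] := H1 z nN; apply: nU2; rewrite zb.
  by have [za|//|//] := H2 z nN; apply: nU1; rewrite za.
move=> H [nNz [U1z|U2z]]; case: H => [//|[V1z V2z]].
  by suff : set0 z by []; rewrite -UV1.
by suff : set0 z by []; rewrite -UV2.
Qed.

(** Each [Q] orders the quasicomponent by putting [x] before [y] if [x] is
selected from [Q], [x] and [y]. Whether [b] lies between [a] and [e] is a matter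
of separation, hence the same for all [Q]: a point between two others for [Q2]
is not before both of them for [Q1]. *)
Lemma admissible_betweenness Q1 N1 Q2 N2 a b e :
  admissible Q1 N1 -> admissible Q2 N2 ->
  quasicomponent a -> quasicomponent b -> quasicomponent e ->
  a <> b -> b <> e -> a <> e ->
  phi (Q2 `|` [set b] `|` [set a]) = a -> phi (Q2 `|` [set b] `|` [set e]) = b ->
  phi (Q1 `|` [set b] `|` [set a]) = b -> phi (Q1 `|` [set b] `|` [set e]) = b ->
  False.
Proof.
move=> aQ1 aQ2 Ca Cb Ce ab be ae Q2a Q2e Q1a Q1e.
pose low Q x := [set z | ~ (Q `|` [set x]) z /\ phi (Q `|` [set x] `|` [set z]) = z].
pose up Q x := [set z | ~ (Q `|` [set x]) z /\ phi (Q `|` [set x] `|` [set z]) <> z].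
have clQ Q N x : admissible Q N -> closed (Q `|` [set x]).
  by move=> [cQ _ _ _ _]; apply: closedU => //; exact: closed_point.
have olow Q N x : admissible Q N -> open (low Q x).
  by move=> aQ; apply: add_point_selected_open => //; exact: clQ aQ.
have oup Q N x : admissible Q N -> open (up Q x).
  by move=> aQ; apply: add_point_rejected_open => //; exact: clQ aQ.
have lowup Q x : low Q x `&` up Q x = set0.
  by apply/seteqP; split=> // z [[_ ?] []].
have lowVup Q N N' x : admissible Q N -> N `<=` N' ->
    forall z, ~ N' z -> z <> x -> low Q x z \/ up Q x z.
  move=> [_ _ _ _ QN] NN' z nN zx.
  have nQ : ~ (Q `|` [set x]) z by move=> [/QN/NN'|].
  by have [?|?] := pselect (phi (Q `|` [set x] `|` [set z]) = z); [left|right].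
have nQx Q N x y : admissible Q N -> quasicomponent x -> x <> y ->
    ~ (Q `|` [set y]) x.
  by move=> aQ Cx xy [Qx|//]; have [_ _ _ _ /(_ _ Qx)] := aQ;
    exact: admissible_notin aQ Cx.
pose N := N1 `|` N2.
have cN : clopen N.
  by have [_ cN1 _ _ _] := aQ1; have [_ cN2 _ _ _] := aQ2; exact: clopenU.
have nNC x : quasicomponent x -> ~ N x.
  by move=> Cx [|]; [exact: admissible_notin aQ1 Cx|exact: admissible_notin aQ2 Cx].
have sub1 : N1 `<=` N by left.
have sub2 : N2 `<=` N by right.
have l2a : low Q2 b a by split=> //; exact: nQx aQ2 Ca ab.
have u2e : up Q2 b e.
  by split; [exact: nQx aQ2 Ce (nesym be)|rewrite Q2e].
(* the clopen unions contain two of the three points but not the third *)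
have contra U x y : clopen U -> quasicomponent x -> quasicomponent y ->
    U x -> ~ U y -> False.
  by move=> cU Cx Cy Ux; apply; apply/(quasicomponentE cU Cy); exact: Cx Ux.
have [Q1ae|Q1ae] := admissible_selects_pair aQ1 Ca Ce.
- have l1b : low Q1 a b by split; [exact: nQx aQ1 Cb (nesym ab)|rewrite setUAC].
  apply: (contra _ a e (clopen_setU_cuts cN (olow _ _ b aQ2) (oup _ _ b aQ2)
    (lowup _ _) (olow _ _ a aQ1) (oup _ _ a aQ1) (lowup _ _)
    (lowVup _ _ _ _ aQ2 sub2) (lowVup _ _ _ _ aQ1 sub1) l2a l1b)) => //.
    by split; [exact: nNC|left].
  move=> [_ [[_]|[_]]]; first by rewrite Q2e.
  by rewrite Q1ae.
- have l1b : low Q1 e b by split; [exact: nQx aQ1 Cb be|rewrite setUAC].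
  have split2 z : ~ N z -> z <> b -> up Q2 b z \/ low Q2 b z.
    by move=> nN zb; rewrite orC; exact: lowVup _ _ _ _ aQ2 sub2 z nN zb.
  have uplow : up Q2 b `&` low Q2 b = set0 by rewrite setIC.
  apply: (contra _ e a (clopen_setU_cuts cN (oup _ _ b aQ2) (olow _ _ b aQ2)
    uplow (olow _ _ e aQ1) (oup _ _ e aQ1) (lowup _ _)
    split2 (lowVup _ _ _ _ aQ1 sub1) u2e l1b)) => //.
    by split; [exact: nNC|left].
  move=> [_ [[_]|[_]]]; first by rewrite Q2a.
  by rewrite setUAC Q1ae => /esym.
Qed.

Hypotheses (cMs : clopen Ms) (nMsp : ~ Ms p).

(** If the winner of a duel changed infinitely often along an increasing
sequence, both points would be limits of the selected points. *)
Lemma duel_eventually_constant x y : quasicomponent x -> quasicomponent y ->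
  x <> y -> exists M, [/\ clopen M, ~ M p, Ms `<=` M &
    forall Q N, admissible Q N -> M `<=` Q ->
      phi (Q `|` [set x] `|` [set y]) = phi (M `|` [set x] `|` [set y])].
Proof.
move=> Cx Cy xy; pose v Q := phi (Q `|` ([set x] `|` [set y])).
suff : exists M, [/\ clopen M, ~ M p, Ms `<=` M &
    forall Q N, admissible Q N -> M `<=` Q -> v Q = v M].
  by move=> [M [cM nM MM H]]; exists M; split=> // Q N; rewrite -!setUA; exact: H.
apply: contrapT => /forallNP nM.
pose P M := [/\ clopen M, ~ M p & Ms `<=` M].
pose R (_ : nat) M M' := exists Q, [/\ closed Q, M `<=` Q, Q `<=` M' & v Q <> v M].
have [||M [_ MP]] := @choice_sequence _ P R Ms; first by split.
  move=> n M [cM nMp MsM]; apply: contrapT => /forallNP nM'; apply: (nM M).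
  split=> // Q N [cQ cN nNp MsQ QN] MQ; apply: contrapT => vQ.
  apply: (nM' N); split; last by exists Q.
  by split=> //; apply: subset_trans QN.
have [Q QP] := choice (fun n => (MP n).2).
have adM n : admissible (M n) (M n).
  by have [[cM nMp MsM] _] := MP n; split=> //; exact: cM.2.
have adQ n : admissible (Q n) (M n.+1).
  have [[_ _ MsM] _] := MP n; have [[cM nMp _] _] := MP n.+1.
  by have [cQ MQ QM _] := QP n; split=> //; exact: subset_trans MQ.
have MSn n : M n `<=` M n.+1.
  by have [_ MQ QM _] := QP n; exact: subset_trans QM.
have Mi m n : m <= n -> M m `<=` M n.
  move=> /subnK <-; elim: (n - m) => [//|k IH]; rewrite addSn.
  by apply: subset_trans IH _; exact: MSn.
have Qi m n : m <= n -> Q m `<=` Q n.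
  rewrite leq_eqVlt => /orP [/eqP -> //|/Mi mn].
  have [_ _ QM _] := QP m; have [_ MQ _ _] := QP n.
  by apply: subset_trans MQ; apply: subset_trans mn.
have QM : \bigcup_n Q n = \bigcup_n M n.
  apply/seteqP; split=> z [n _ Hz].
    by exists n.+1 => //; have [_ _ H _] := QP n; exact: H.
  by exists n => //; have [_ H _ _] := QP n; exact: H.
have cxy : nonempty_closed ([set x] `|` [set y]).
  by apply: nonempty_closed1 => //; exact: closed_point.
pose Z := closure (\bigcup_n M n).
have cZ : nonempty_closed (Z `|` ([set x] `|` [set y])).
  by apply: nonempty_closedU => //; exact: closed_closure.
have main z : z <> v Z -> exists m, forall n, m <= n -> v (M n) <> z /\ v (Q n) <> z.
  move=> zv; have near : vietoris_near (Z `|` ([set x] `|` [set y]))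
      (fun T => (~` [set z]) (phi T)).
    apply: selection_near => //; last by apply: nesym.
    by apply: closed_openC; exact: closed_point.
  have [|m Hm] := vietoris_near_bigcup Mi _ cxy near.
    by move=> n; have [] := adM n.
  rewrite /Z -QM in near; have [|m' Hm'] := vietoris_near_bigcup Qi _ cxy near.
    by move=> n; have [] := adQ n.
  exists (maxn m m') => n; rewrite geq_max => /andP [mn m'n].
  by split; [exact: Hm|exact: Hm'].
have alt n : v (Q n) <> v (M n) by have [] := QP n.
have := fun n => admissible_selects_pair (adM n) Cx Cy.
have := fun n => admissible_selects_pair (adQ n) Cx Cy.
have [zv|zv] : x <> v Z \/ y <> v Z.
- by apply/not_andP => -[xv yv]; apply: xy; rewrite xv.
- have [m /(_ m (leqnn m)) [H1 H2]] := main _ zv => /(_ m) + /(_ m).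
  rewrite -!setUA -!/(v _) => -[//|Qy] [//|My].
  by apply: (alt m); rewrite Qy My.
- have [m /(_ m (leqnn m)) [H1 H2]] := main _ zv => /(_ m) + /(_ m).
  rewrite -!setUA -!/(v _) => -[Qx|//] [Mx|//].
  by apply: (alt m); rewrite Qx Mx.
Qed.

(** Large clopen sets missing [p], together with the quasicomponent of [p],
exhaust the space. *)
Lemma exhaust_finite_open (l : seq (set X)) M : clopen M -> ~ M p ->
  (forall A, A \in l -> A !=set0) ->
  exists M' t, [/\ clopen M', ~ M' p, M `<=` M', [set` t] `<=` quasicomponent &
                   meets_all (M' `|` [set` t]) l].
Proof.
move=> cM nMp; elim: l => [|A l IH] l0.
  by exists M, [::]; split=> // [z|A]; rewrite /= in_nil.
have [|M' [t [cM' nM'p MM' tC tl]]] := IH.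
  by move=> B Bl; apply: l0; rewrite inE Bl orbT.
have [x Ax] := l0 A (mem_head _ _).
have [Cx|] := pselect (quasicomponent x).
  exists M', (x :: t); split=> //.
    by move=> z /=; rewrite inE => /predU1P [->//|/tC].
  move=> B; rewrite inE => /orP [/eqP ->|Bl].
    by exists x; split=> //; right; rewrite /= mem_head.
  apply: (meets_all_subset _ tl) Bl => z [|tz]; [by left|right].
  by rewrite /= inE (tz : z \in t) orbT.
move=> /existsNP [N /not_implyP [cN /not_implyP [Nx nNp]]].
exists (M' `|` N), t; split=> //.
- exact: clopenU.
- by move=> [].
- by move=> z /MM'; left.
move=> B; rewrite inE => /orP [/eqP ->|Bl].
  by exists x; split=> //; left; right.
by apply: (meets_all_subset _ tl) Bl => z [|]; [left; left|right].
Qed.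

Definition loses_duels M c := forall Q N, admissible Q N -> M `<=` Q ->
  phi (Q `|` [set c] `|` [set p]) = c.

(** Near [p] every point of the quasicomponent loses against [c] for [M]. As
[phi setT = p], some large [Q2] selects a point [y] close to [p] from a finite
set containing [c] and [p], so that [y], [c], [p] come in this order for [Q2]:
then [c] is between [y] and [p], although it comes first for [M]. *)
Lemma not_loses_duels M c : clopen M -> ~ M p -> Ms `<=` M ->
  quasicomponent c -> c <> p -> ~ loses_duels M c.
Proof.
move=> cM nMp MsM Cc cp H.
have adm M' : clopen M' -> ~ M' p -> M `<=` M' -> admissible M' M'.
  by move=> cM' nM'p MM'; split=> //; [exact: cM'.2|exact: subset_trans MM'].
have aM := adm M cM nMp (@subset_refl _ M).
have [U1 [U2 [oU1 oU2 U1c U2p U12]]] := open_separation hX cp.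
have cMc : closed (M `|` [set c]).
  by apply: closedU; [exact: cM.2|exact: closed_point].
have [|U [oU Up HU]] := selection_setU1_near hX phiS (x := p) cMc oU1.
  by rewrite (H M M).
have first y : (U `&` U2) y -> quasicomponent y ->
    phi (M `|` [set c] `|` [set y]) = c.
  move=> [Uy U2y] Cy; have [//|phiy] := admissible_selects_pair aM Cc Cy.
  suff : set0 y by []; rewrite -U12; split=> //; rewrite -phiy.
  by apply: HU => [|z -> //]; split; [exact: closed_point|exists y].
have nTc : nonempty_closed [set: X] by split; [exact: closedT|exists p].
have [|V [l [oV ol SV Sl near]]] :=
  selection_near phiS nTc (openI oU oU2); first by rewrite phiT.
have [|Q2 [t [cQ2 nQ2p MQ2 tC tl]]] := exhaust_finite_open (l := l) cM nMp.
  by move=> A /Sl [x [_ Ax]]; exists x.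
have aQ2 := adm _ cQ2 nQ2p MQ2.
pose S := Q2 `|` [set` t] `|` ([set c] `|` [set p]).
have cS : nonempty_closed S.
  apply: nonempty_closedU; first by apply: closedU; [exact: cQ2.2|exact: closed_seq].
  by apply: nonempty_closed1 => //; exact: closed_point.
have Uy : (U `&` U2) (phi S).
  apply: near => //; first by move=> z _; exact: SV.
  by apply: meets_all_subset tl; left.
set y := phi S in Uy.
have yc : y <> c.
  by move=> yc; suff : set0 c by []; rewrite -U12; split=> //; rewrite -yc; case: Uy.
have Cp := quasicomponent_self.
have ctC : [set` c :: t] `<=` quasicomponent.
  by move=> z /=; rewrite inE => /predU1P [->//|/tC].
have ptC : [set` p :: t] `<=` quasicomponent.
  by move=> z /=; rewrite inE => /predU1P [->//|/tC].
have nN : ~ Q2 y.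
  have := admissible_selects_finite aQ2 ctC Cp.
  by rewrite setU_seq_cons -setUA [[set p] `|` _]setUC.
have Sy : S y by exact: selection_in.
have Cy : quasicomponent y.
  by case: Sy => [[//|/tC//]|[->|->]].
have Q2c : phi (Q2 `|` [set c] `|` [set y]) = y.
  apply: (admissible_selects_first aQ2 ptC Cc Cy).
  rewrite setU_seq_cons -[RHS]/(phi S); congr phi; apply/seteqP; split=> z.
    by move=> [[|[|->]]|->] => [?|?||]; rewrite /S; [left|right; left|exact: Sy|
      right; right].
  by move=> [?|[->|->]]; [left; left|left; right; left|right].
have Q2p : phi (Q2 `|` [set p] `|` [set y]) = y.
  apply: (admissible_selects_first aQ2 ctC Cp Cy).
  rewrite setU_seq_cons -[RHS]/(phi S); congr phi; apply/seteqP; split=> z.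
    by move=> [[|[|->]]|->] => [?|?||]; rewrite /S; [left|right; right|exact: Sy|
      right; left].
  by move=> [?|[->|->]]; [left; left|right|left; right; left].
have Q2cp := H _ _ aQ2 MQ2.
have yp : y <> p.
  move=> yp; apply: cp; rewrite -Q2cp.
  by move: Q2c; rewrite yp.
apply: (admissible_betweenness aM aQ2 Cy Cc Cp) => //.
- by rewrite first.
- exact: H aM _.
Qed.

(** If [p] kept losing duels against varying points, two such points [c] and [d]
would have [p] between them for some [Q], and behind [p] both for a larger
one. *)
Lemma eventually_wins_duels : exists M, [/\ clopen M, ~ M p, Ms `<=` M &
  forall Q N c, admissible Q N -> M `<=` Q -> quasicomponent c ->
    phi (Q `|` [set c] `|` [set p]) = p].
Proof.
apply: contrapT => /forallNP nM.
have Cp := quasicomponent_self.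
have bad M : clopen M -> ~ M p -> Ms `<=` M -> exists Q N c,
    [/\ admissible Q N, M `<=` Q, quasicomponent c, c <> p &
        phi (Q `|` [set c] `|` [set p]) = c].
  move=> cM nMp MsM; apply: contrapT => nex; apply: (nM M); split=> //.
  move=> Q N c aQ MQ Cc; have [cp|cp] := pselect (c = p).
    by have [->|//] := admissible_selects_pair aQ Cc Cp.
  have [phic|//] := admissible_selects_pair aQ Cc Cp.
  by exfalso; apply: nex; exists Q, N, c.
have win c : quasicomponent c -> c <> p -> exists M, [/\ clopen M, ~ M p, Ms `<=` M &
    forall Q N, admissible Q N -> M `<=` Q -> phi (Q `|` [set c] `|` [set p]) = p].
  move=> Cc cp; have [M [cM nMp MsM Mconst]] := duel_eventually_constant Cc Cp cp.
  exists M; split=> // Q N aQ MQ; rewrite (Mconst Q N) //.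
  have aM : admissible M M by split=> //; exact: cM.2.
  have [Mc|//] := admissible_selects_pair aM Cc Cp.
  exfalso; apply: (not_loses_duels cM nMp MsM Cc cp) => Q' N' aQ' MQ'.
  by rewrite (Mconst Q' N').
have [_ [_ [c [_ _ Cc cp _]]]] := bad Ms cMs nMsp (@subset_refl _ _).
have [M [cM nMp MsM winc]] := win c Cc cp.
have [Q2 [N2 [d [aQ2 MQ2 Cd dp Q2d]]]] := bad M cM nMp MsM.
have [M' [cM' nM'p MsM' wind]] := win d Cd dp.
have aQ1 : admissible (M `|` M') (M `|` M').
  have cMM := clopenU cM cM'.
  by split=> //; [exact: cMM.2|move=> []|move=> z /MsM; left].
apply: (admissible_betweenness aQ1 aQ2 Cd Cp Cc) => //.
- exact: nesym.
- by move=> dc; apply: dp; rewrite -Q2d dc (winc _ _ aQ2).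
- by rewrite setUAC.
- by rewrite setUAC (winc _ _ aQ2).
- by rewrite setUAC (wind _ _ aQ1) //; right.
- by rewrite setUAC (winc _ _ aQ1) //; left.
Qed.

Lemma split_finite s M : clopen M -> ~ M p -> exists N t,
  [/\ clopen N, ~ N p, M `<=` N, [set` t] `<=` quasicomponent &
      [set` s] `<=` N `|` [set` t] /\ [set` t] `<=` [set` s]].
Proof.
move=> cM nMp; elim: s => [|x s [N [t [cN nNp MN tC [sNt ts]]]]].
  by exists M, [::]; split.
have tsx : [set` t] `<=` [set` x :: s].
  by move=> z /ts /= zs; rewrite inE zs orbT.
have [Cx|] := pselect (quasicomponent x).
  exists N, (x :: t); split=> //.
    by move=> z /=; rewrite inE => /predU1P [->//|/tC].
  split=> z /=; rewrite inE => /predU1P [->|].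
  - by right; rewrite /= mem_head.
  - by move=> /sNt [|tz]; [left|right; rewrite /= inE (tz : z \in t) orbT].
  - by rewrite inE eqxx.
  - by move=> /tsx.
move=> /existsNP [N' /not_implyP [cN' /not_implyP [N'x nN'p]]].
exists (N `|` N'), t; split=> //.
- exact: clopenU.
- by move=> [].
- by move=> z /MN; left.
split=> // z /=; rewrite inE => /predU1P [->|/sNt [|]].
- by left; right.
- by left; left.
- by right.
Qed.

(** It suffices to treat finite [S]. The points of [S] outside the quasicomponent
can be absorbed into an admissible set; [p] wins the duels against the others. *)
Lemma selects_point_over_clopen : exists M, [/\ clopen M, ~ M p &
  forall S, closed S -> S p -> phi (M `|` S) = p].
Proof.
have [M [cM nMp MsM first]] := eventually_wins_duels.
exists M; split=> // S cS Sp; apply: contrapT => nphi.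
have pS : M `|` S = M `|` [set p] `|` S.
  by rewrite -setUA [[set p] `|` S]setUC add_point_id.
have cMp : closed (M `|` [set p]).
  by apply: closedU; [exact: cM.2|exact: closed_point].
have [||s [sS nphis]] := finite_approximation hX phiS cMp _ cS
  (closed_openC (closed_point hX (x := p))).
- by exists p; right.
- by rewrite -pS.
have [N [t [cN nNp MN tC [sNt ts]]]] := split_finite s cM nMp.
pose Q := M `|` ([set` s] `&` N).
have aQ : admissible Q N.
  split=> //.
  - apply: closedU; first exact: cM.2.
    by apply: closedI; [exact: closed_seq|exact: cN.2].
  - by move=> z /MsM; left.
  - by move=> z [/MN|[]].
have eqQ : M `|` [set p] `|` [set` s] = Q `|` [set` t] `|` [set p].
  apply/seteqP; split=> z.
    move=> [[Mz|->]|sz]; [by left; left; left|by right|].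
    by have [Nz|tz] := sNt z sz; [left; left; right|left; right].
  by move=> [[[Mz|[sz _]]|/ts sz]|->]; [left; left|right|right|left; right].
have Cp := quasicomponent_self.
rewrite eqQ in nphis.
have nN := admissible_selects_finite aQ tC Cp.
have cK : closed (Q `|` [set` t]).
  by have [cQ _ _ _ _] := aQ; apply: closedU => //; exact: closed_seq.
set y := phi _ in nphis nN.
have [[Qy|ty]|//] := selection_in phiS (nonempty_closed1 hX p cK).
  by apply: nN; have [_ _ _ _] := aQ; exact.
apply: nphis; have Cy := tC y ty.
have <- := first Q N y aQ (fun z Mz => or_introl Mz) Cy.
rewrite setUAC; apply/esym; apply: (admissible_selects_first aQ tC Cp Cy).
rewrite [X in phi X](_ : _ = Q `|` [set` t] `|` [set p]) //.
by rewrite setUA add_point_id //; left; right.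
Qed.

End NotApproachable.

(** * Continuous selections of the hyperspace as selections of sets *)

Section Hyperspace.
Variable X : topologicalType.
Implicit Types (S T : hyperspace X) (V : set (set X)).

Lemma hyperspace_eq S T : hyper_set S = hyper_set T -> S = T.
Proof.
case: S T => [S cS S0] [T cT T0] /= ST; subst T.
by rewrite (Prop_irrelevance cS cT) (Prop_irrelevance S0 T0).
Qed.

Lemma hyperspace_nonempty_closed S : nonempty_closed (hyper_set S).
Proof. by split; [exact: hyper_closed|exact: hyper_neq0]. Qed.

Lemma vietoris_set_near S V : vietoris_index V -> vietoris_set V S ->
  vietoris_near (hyper_set S) (fun T : set X => T `<=` \bigcup_(A in V) A /\
                            forall A, V A -> T `&` A !=set0).
Proof.
move=> [/finite_seqP [s ->] oV] [SV SA].
exists (\bigcup_(A in [set` s]) A), s; split=> //.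
by apply: bigcup_open.
Qed.

Lemma open_hyperspaceE : @open (hyperspace X) =
  [set \bigcup_(A in B) A |
     B in subset^~ (finI_from (@vietoris_index X) (@vietoris_set X))].
Proof. by []. Qed.

Lemma nbhs_vietoris_near S (P : set (hyperspace X)) : nbhs S P ->
  vietoris_near (hyper_set S) (fun T : set X =>
    forall T' : hyperspace X, hyper_set T' = T -> P T').
Proof.
rewrite nbhsE => -[O [+ OS] BP]; rewrite open_hyperspaceE => -[B sB BO].
move: OS BP; rewrite -{O}BO => -[C BC CS] BP.
have [D sD DC] := sB C BC.
apply: (@vietoris_near_mono _ _ (fun T : set X => forall V, V \in enum_fset D ->
    T `<=` \bigcup_(A in V) A /\ forall A, V A -> T `&` A !=set0)).
  move=> T cT TD T' T'T; apply: BP; exists C => //; rewrite -DC => V DV.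
  by rewrite /vietoris_set /= T'T; exact: TD.
have {}DS V : V \in enum_fset D -> vietoris_index V /\ vietoris_set V S.
  move=> DV; split; first by have := sD V DV; rewrite inE.
  by move: CS; rewrite -DC; exact.
elim: (enum_fset D) DS => [|V l IH] DS.
  by exists setT, [::]; split=> //; exact: openT.
have [iV SV] := DS V (mem_head _ _).
apply: vietoris_near_mono (vietoris_near_and (vietoris_set_near iV SV) (IH _)).
  by move=> T cT [TV Tl] V'; rewrite inE => /orP [/eqP ->//|/Tl].
by move=> V' V'l; apply: DS; rewrite inE V'l orbT.
Qed.

Lemma near_nbhs_vietoris S (P : set X -> Prop) :
  vietoris_near (hyper_set S) P -> nbhs S [set T : hyperspace X | P T].
Proof.
move=> [V [s [oV os SV Ss H]]].
pose C : set (set X) := [set` V :: [seq A `&` V | A <- s]].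
have CP A : C A -> A = V \/ exists2 B, B \in s & A = B `&` V.
  by rewrite /C /= inE => /predU1P [->|/mapP [B Bs ->]]; [left|right; exists B].
have iC : vietoris_index C.
  split; first by apply/finite_seqP; exists (V :: [seq A `&` V | A <- s]).
  by move=> A /CP [->//|[B Bs ->]]; apply: openI => //; exact: os.
have CV : C V by rewrite /C /= mem_head.
rewrite nbhsE; exists (vietoris_set C); first split.
- rewrite open_hyperspaceE; exists [set vietoris_set C]; last by rewrite bigcup_set1.
  by move=> _ ->; exact: finI_from1.
- split; first by move=> x Sx; exists V => //; exact: SV.
  move=> A /CP [->|[B Bs ->]].
    by have [x Sx] := hyper_neq0 S; exists x; split=> //; exact: SV.
  by have [x [Sx Bx]] := Ss B Bs; exists x; split=> //; split=> //; exact: SV.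
move=> T [TC TA]; apply: H; first exact: hyperspace_nonempty_closed.
  by move=> x /TC [A /CP [->//|[B _ ->]] []].
move=> B Bs; have [|x [Tx [Bx _]]] := TA (B `&` V); last by exists x.
by rewrite /C /= inE; apply/orP; right; apply/mapP; exists B.
Qed.

Definition set_function (f : hyperspace X -> X) (p : X) (S : set X) : X :=
  if pselect (nonempty_closed S) is left h then f (Hyperspace h.1 h.2) else p.

Lemma set_functionE f p S : set_function f p S = f S.
Proof.
rewrite /set_function; case: pselect => [h|[]]; last first.
  exact: hyperspace_nonempty_closed.
by congr f; exact: hyperspace_eq.
Qed.

Lemma continuous_selection_set_function f p :
  continuous_selection f -> set_selection (set_function f p).
Proof.
move=> [fS fc] S cS; pose S' := Hyperspace cS.1 cS.2.
rewrite -[S]/(hyper_set S') set_functionE; split; first exact: fS.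
move=> W oW WS.
have : nbhs S' (f @^-1` W) by apply: fc; apply: open_nbhs_nbhs.
move=> /nbhs_vietoris_near; apply: vietoris_near_mono => T cT.
move=> /(_ (Hyperspace cT.1 cT.2) erefl) WT.
by rewrite -[T]/(hyper_set (Hyperspace cT.1 cT.2)) set_functionE.
Qed.

Lemma set_selection_continuous (phi : set X -> X) :
  set_selection phi -> continuous_selection (fun S : hyperspace X => phi S).
Proof.
move=> phiS; split=> S.
  by have := selection_in phiS (hyperspace_nonempty_closed S).
move=> N; rewrite nbhsE => -[W [oW WS] WN].
have := near_nbhs_vietoris
  (selection_near phiS (hyperspace_nonempty_closed S) oW WS).
by apply: filterS => T /WN.
Qed.

End Hyperspace.

(** The two cases are open conditions on [S], because [M] is clopen; outside [M]
the point [phi (M `|` S)] can only belong to [S]. *)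
Lemma selection_modify (X : topologicalType) (phi : set X -> X) (M : set X) :
  set_selection phi -> clopen M ->
  set_selection (fun S => if pselect (M (phi (M `|` S))) then phi S
                          else phi (M `|` S)).
Proof.
move=> phiS [oM cM] S cS.
case: pselect => [MS|nMS] /=.
  split; first exact: selection_in cS.
  move=> W oW WS; have := vietoris_near_and (selection_near phiS cS oW WS)
    (selection_setU_near phiS cM cS oM MS).
  by apply: vietoris_near_mono => T cT [WT MT]; case: pselect.
split; first by have [//|] := selection_in phiS (nonempty_closedU cM cS).
move=> W oW WS; have := selection_setU_near phiS cM cS
  (openI oW (closed_openC cM)) (conj WS nMS).
by apply: vietoris_near_mono => T cT [WT nMT]; case: pselect.
Qed.

Section SelectionMaximal.
Variables (X : topologicalType) (hX : hausdorff_space X) (p : X).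

Lemma selection_maximalP : selection_maximal p <->
  exists phi : set X -> X, set_selection phi /\
    forall S, nonempty_closed S -> S p -> phi S = p.
Proof.
split=> [[f fs fp]|[phi [phiS phip]]].
  exists (set_function f p); split; first exact: continuous_selection_set_function.
  move=> S cS Sp; rewrite -[S]/(hyper_set (Hyperspace cS.1 cS.2)) set_functionE.
  exact: fp.
exists (fun S : hyperspace X => phi S); first exact: set_selection_continuous.
by move=> S; apply: phip; exact: hyperspace_nonempty_closed.
Qed.

Lemma nonempty_closedT : nonempty_closed [set: X].
Proof. by split; [exact: closedT|exists p]. Qed.

Lemma Theta_selection : Theta X p ->
  exists phi : set X -> X, set_selection phi /\ phi setT = p.
Proof.
move=> [f fs [S ST <-]]; exists (set_function f p).
split; first exact: continuous_selection_set_function.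
by rewrite -ST set_functionE.
Qed.

Lemma selection_maximal_Theta : selection_maximal p -> Theta X p.
Proof.
move=> [f fs fp]; exists f => //.
by exists (Hyperspace nonempty_closedT.1 nonempty_closedT.2) => //; apply: fp.
Qed.

(** Over [M], the selection of [selection_modify] takes the value [p] on every set
containing [p], as [p] is not in [M]. *)
Lemma Theta_not_Omega_maximal :
  Theta X p -> ~ countably_approachable p -> selection_maximal p.
Proof.
move=> /Theta_selection [phi [phiS phiT]] nap.
have [Ms [cMs nMsp MsP]] := selects_point_over_large_sets hX phiS phiT nap.
have [M [cM nMp Mp]] := selects_point_over_clopen hX phiS phiT MsP cMs nMsp.
apply/selection_maximalP; eexists; split; first exact: selection_modify phiS cM.
by move=> S [cS _] Sp; case: pselect => /=; rewrite Mp.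
Qed.

Lemma maximal_approachable_countable_base :
  selection_maximal p -> countably_approachable p -> countable_clopen_base p.
Proof.
move=> /selection_maximalP [phi [phiS phip]] ap.
have [op|nop] := pselect (open [set p]).
  apply: (@countable_clopen_base_seq _ _ (fun=> [set p])) => // [_|W _ Wp].
    by split=> //; exact: closed_point.
  by exists 0 => _ ->.
have [D Dp] := approachable_clopen_approach hX ap nop.
by have := maximal_countable_clopen_base hX phiS phip Dp.
Qed.

Lemma countable_base_selection_maximal :
  (exists f : hyperspace X -> X, continuous_selection f) ->
  countable_clopen_base p -> selection_maximal p.
Proof.
move=> [f fs] bp; apply/selection_maximalP.
by have := countable_clopen_base_maximal
  (continuous_selection_set_function p fs) bp.
Qed.

End SelectionMaximal.

Theorem theorem1p4 (X : topologicalType)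
    (hinf : infinite_set [set: X]) (hX : hausdorff_space X)
    (hsel : exists f : hyperspace X -> X, continuous_selection f) :
  Theta X `\` Omega X `<=` Theta_star X /\
  Theta_star X `&` Omega X = Omega_star X.
Proof.
split=> [p [Tp nOp]|].
  by split=> //; exact: Theta_not_Omega_maximal.
apply/seteqP; split=> p.
  by move=> [[_ mp] Op]; split=> //; exact: maximal_approachable_countable_base.
move=> [Op bp]; have mp := countable_base_selection_maximal hsel bp.
by split=> //; split=> //; exact: selection_maximal_Theta.
Qed.
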